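(* Let $\{x_k\}$ be generated by Algorithm TRishBB applied to $f$. Suppose that: (i) $f:\mathbb{R}^n\to\mathbb{R}$ is continuously differentiable, bounded below by $f_*$, and there is $L>0$ with $f(x)\le f(y)+\nabla f(y)^T(x-y)+\frac{L}{2}\|x-y\|^2$ for all $x,y\in\mathbb{R}^n$; (ii) the Polyak-Lojasiewicz condition holds with some $c\in(0,\infty)$: $2c(f(x)-f_* )\le\|\nabla f(x)\|^2$ for all $x\in\mathbb{R}^n$; (iii) for all $k$, $\mathbb{E}_k[g_k]=\nabla f(x_k)$, and there is a constant $M_g>0$ such that $\mathbb{E}_k[\|\nabla f(x_k)-g_k\|^2]\le M_g$ for all $k$; (iv) $$0<\alpha<\min\left\{\frac{\gamma_2}{8\gamma_1^2L},\ \frac{8}{\gamma_2c}\right\},\qquad \mu_{min}\ge\frac{4\gamma_1\alpha}{5}.$$ Let $\theta_3=\frac{\gamma_1^2}{\gamma_2}-\frac{\gamma_2}{16}$. Then the generated sequence satisfies $$\mathbb{E}[f(x_{k+1})]-f_*\ \xrightarrow{k\to\infty}\ \frac{8\,\theta_3M_g}{\gamma_2\,c}.$$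
   Context: Objective: $f(x)=\frac1N\sum_{i=1}^N f_i(x)$ with each $f_i:\mathbb{R}^n\to\mathbb{R}$ continuously differentiable. $\|\cdot\|$ is the Euclidean norm. Algorithm TRishBB: choose an initial $x_0\in\mathbb{R}^n$, constants $\alpha>0$, $0<\gamma_2\le\gamma_1<\infty$, $\mu_{min}>0$, and $\mu_0>0$. At each iteration $k=0,1,2,\dots$: compute a stochastic gradient $g_k\in\mathbb{R}^n$ (a random vector approximating $\nabla f(x_k)$); set $$\Delta_k=\begin{cases}\alpha\gamma_1\|g_k\| & \text{if }\|g_k\|\in[0,\frac1{\gamma_1}),\\ \alpha & \text{if }\|g_k\|\in[\frac1{\gamma_1},\frac1{\gamma_2}],\\ \alpha\gamma_2\|g_k\| & \text{if }\|g_k\|\in(\frac1{\gamma_2},\infty);\end{cases}$$ let $p_k$ be the solution of $\min_{p\in\mathbb{R}^n} m_k(p)=g_k^Tp+\frac{1}{2\mu_k}\|p\|^2$ subject to $\|p\|\le\Delta_k$ (so $p_k=-\mu_kg_k$ if $\|\mu_kg_k\|<\Delta_k$, and $p_k=-\frac{\Delta_k}{\|g_k\|}g_k$ otherwise, with $p_k=0$ if $g_k=0$); set $x_{k+1}=x_k+p_k$; form a parameter $\mu_{k+1}\ge\mu_{min}$. It is assumed that $\mu_k\ge\mu_{min}$ for all $k\ge0$. $\mathbb{E}_k[\cdot]$ is the conditional expectation given that the algorithm has reached $x_k$ at iteration $k$; $\mathbb{E}[\cdot]$ is the expected value taken with the joint distribution of all random variables.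
   Formalization: Convergence of E[f(x_{k+1})]-f_* to 8θ₃M_g/(γ₂c) is false (e.g. g_k = ∇f(x_k) exactly gives limit 0); what is proved is that E[f(x_{k+1})]-f_* is at most b_k for all k, for some sequence b_k converging to that value. *)

(* Defs.v *)
From HB Require Import structures.
From mathcomp Require Export all_boot all_order all_algebra.
From mathcomp Require Export all_classical all_reals all_analysis.
Export Order.TTheory GRing.Theory Num.Theory.
Export numFieldNormedType.Exports.

Set Implicit Arguments.
Unset Strict Implicit.
Unset Printing Implicit Defensive.

Local Open Scope classical_set_scope.
Local Open Scope ring_scope.

(* The library norm `|_| on 'rV[R]_n is the sup norm, so the Euclidean one is
   defined here; both induce the library topology on 'rV[R]_n. *)
Definition dot (R : realType) (n : nat) (u v : 'rV[R]_n) : R :=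
  \sum_(i < n) u 0 i * v 0 i.

Definition enorm (R : realType) (n : nat) (u : 'rV[R]_n) : R :=
  Num.sqrt (dot u u).

Definition grad (R : realType) (n : nat) (f : 'rV[R]_n -> R) (x : 'rV[R]_n) :
    'rV[R]_n :=
  \row_(i < n) 'D_(delta_mx 0 i) f x.

Definition continuously_differentiable (R : realType) (n : nat)
    (f : 'rV[R]_n -> R) : Prop :=
  (forall x, differentiable f x) /\ continuous (grad f).

Definition borel_sets (R : realType) (n : nat) : set (set 'rV[R]_n) :=
  <<s [set U : set 'rV[R]_n | open U] >>.

Definition random_vector (d : measure_display) (T : measurableType d)
    (R : realType) (n : nat) (X : T -> 'rV[R]_n) : Prop :=
  forall B, borel_sets B -> measurable (X @^-1` B).

Definition sigma_of (d : measure_display) (T : measurableType d)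
    (R : realType) (n : nat) (X : T -> 'rV[R]_n) : set (set T) :=
  preimage_set_system setT X (@borel_sets R n).

(* Y is a version of the conditional expectation of X given the
   sub-sigma-algebra G. *)
Record is_cond_expectation (d : measure_display) (T : measurableType d)
    (R : realType) (P : probability T R) (G : set (set T)) (X Y : T -> R) :
    Prop := IsCondExpectation {
  ce_measurable : forall B : set R, measurable B -> G (Y @^-1` B) ;
  ce_integrable_arg : P.-integrable setT (EFin \o X) ;
  ce_integrable : P.-integrable setT (EFin \o Y) ;
  ce_integral : forall A : set T, G A ->
    (\int[P]_(w in A) (X w)%:E = \int[P]_(w in A) (Y w)%:E)%E
}.

(* Conditional expectations are unique almost surely, so quantifying the
   version existentially or universally is the same. *)
Definition cond_expectation_le (d : measure_display) (T : measurableType d)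
    (R : realType) (P : probability T R) (G : set (set T)) (X : T -> R)
    (M : R) : Prop :=
  exists2 Y : T -> R, is_cond_expectation P G X Y &
    {ae P, forall w, Y w <= M}.

Definition tr_radius (R : realType) (alpha gamma1 gamma2 t : R) : R :=
  if t < gamma1^-1 then alpha * gamma1 * t
  else if t <= gamma2^-1 then alpha
  else alpha * gamma2 * t.

Definition tr_model (R : realType) (n : nat) (g : 'rV[R]_n) (mu : R)
    (p : 'rV[R]_n) : R :=
  dot g p + (2 * mu)^-1 * enorm p ^+ 2.

Definition tr_solution (R : realType) (n : nat) (g : 'rV[R]_n) (mu Delta : R)
    (p : 'rV[R]_n) : Prop :=
  enorm p <= Delta /\
  forall q, enorm q <= Delta -> tr_model g mu p <= tr_model g mu q.

(* Runs of the algorithm on the probability space (T, P): the rule producing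
   mu k.+1 is left free, subject to the lower bound mumin. *)
Record TRishBB (d : measure_display) (T : measurableType d) (R : realType)
    (n : nat) (x0 : 'rV[R]_n) (alpha gamma1 gamma2 mumin mu0 : R)
    (x g p : nat -> T -> 'rV[R]_n) (mu : nat -> T -> R) : Prop :=
  IsTRishBB {
  trish_alpha : 0 < alpha ;
  trish_gamma : 0 < gamma2 <= gamma1 ;
  trish_mumin : 0 < mumin ;
  trish_mu0 : 0 < mu0 ;
  trish_x_random : forall k, random_vector (x k) ;
  trish_g_random : forall k, random_vector (g k) ;
  trish_mu_random : forall k, measurable_fun setT (mu k) ;
  trish_x_init : forall w, x 0 w = x0 ;
  trish_mu_init : forall w, mu 0 w = mu0 ;
  trish_mu_ge : forall k w, mumin <= mu k w ;
  trish_step : forall k w,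
    tr_solution (g k w) (mu k w)
      (tr_radius alpha gamma1 gamma2 (enorm (g k w))) (p k w) ;
  trish_update : forall k w, x k.+1 w = x k w + p k w
}.

(* Main.v *)
(* Every step is [- s *: g] with
   [4/5 alpha gamma2 <= s <= alpha gamma1], so the quadratic upper model and
   Young's inequality give, pointwise,
     f(x_{k+1}) <= f(x_k) - (alpha gamma2 / 16) |grad f(x_k)|^2
                   + alpha theta3 |grad f(x_k) - g_k|^2.
   By the Polyak-Lojasiewicz condition the expected gap
   [a_k = E[f(x_k)] - fstar] satisfies [a_{k+1} <= q a_k + alpha theta3 Mg]
   with [q = 1 - alpha gamma2 c / 8] in [0, 1), and the fixed point of this
   recursion is [8 theta3 Mg / (gamma2 c)]. *)
Require Import Defs.
From mathcomp Require Import ring lra measurable_realfun.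

Local Open Scope classical_set_scope.
Local Open Scope ring_scope.

(** * Bilinearity and positivity of the Euclidean product *)

Section EuclideanProduct.
Context {R : realType} {n : nat}.
Implicit Types (u v w : 'rV[R]_n) (a : R).

Lemma dotC u v : dot u v = dot v u.
Proof. by apply: eq_bigr => i _; rewrite mulrC. Qed.

Lemma dotDl u v w : dot (u + v) w = dot u w + dot v w.
Proof. by rewrite -big_split; apply: eq_bigr => i _; rewrite mxE mulrDl. Qed.

Lemma dotDr u v w : dot u (v + w) = dot u v + dot u w.
Proof. by rewrite dotC dotDl !(dotC u). Qed.

Lemma dotZl a u v : dot (a *: u) v = a * dot u v.
Proof. by rewrite mulr_sumr; apply: eq_bigr => i _; rewrite mxE mulrA. Qed.

Lemma dotZr a u v : dot u (a *: v) = a * dot u v.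
Proof. by rewrite dotC dotZl dotC. Qed.

Lemma dotNl u v : dot (- u) v = - dot u v.
Proof. by rewrite -scaleN1r dotZl mulN1r. Qed.

Lemma dotNr u v : dot u (- v) = - dot u v.
Proof. by rewrite dotC dotNl dotC. Qed.

Definition dotE := (dotDl, dotDr, dotNl, dotNr, dotZl, dotZr).

Lemma dot_ge0 u : 0 <= dot u u.
Proof. by apply: sumr_ge0 => i _; rewrite -expr2 sqr_ge0. Qed.

Lemma dot_le0_eq0 u : dot u u <= 0 -> u = 0.
Proof.
move=> u0; have /eqP : dot u u = 0 by apply/le_anti; rewrite u0 dot_ge0.
rewrite psumr_eq0 => [/allP uu0|i _]; last by rewrite -expr2 sqr_ge0.
apply/rowP => i; rewrite mxE; apply/eqP.
by have := uu0 i (mem_index_enum _); rewrite mulf_eq0 orbb.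
Qed.

Lemma sqr_enorm u : enorm u ^+ 2 = dot u u.
Proof. by rewrite sqr_sqrtr// dot_ge0. Qed.

Lemma enorm_ge0 u : 0 <= enorm u.
Proof. exact: sqrtr_ge0. Qed.

Lemma enorm_le_dot u a : 0 <= a -> (enorm u <= a) = (dot u u <= a ^+ 2).
Proof.
move=> a0; rewrite -sqr_enorm ler_pXn2r// nnegrE//; exact: enorm_ge0.
Qed.

End EuclideanProduct.

(* The step is the projection of [- mu *: g] onto the ball; with the radius
   written as [t * enorm g] this needs no case split on [g = 0]. *)
Lemma tr_solutionE (R : realType) (n : nat) (g p : 'rV[R]_n) (mu t : R) :
  0 < mu -> 0 < t -> tr_solution g mu (t * enorm g) p ->
  p = - Num.min mu t *: g.
Proof.
move=> mu0 t0; set s := Num.min mu t => -[pD pmin].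
have s0 : 0 < s by rewrite lt_min mu0.
have [smu st] : s <= mu /\ s <= t by rewrite !ge_min !lexx orbT.
have gg := dot_ge0 g; have D0 : 0 <= t * enorm g.
  by rewrite mulr_ge0 ?enorm_ge0// ltW.
have qD : enorm (- s *: g) <= t * enorm g.
  rewrite enorm_le_dot// !dotE exprMn sqr_enorm mulrA mulrNN.
  by rewrite ler_wpM2r// -expr2 ler_pXn2r// nnegrE ltW.
move: (pmin _ qD) pD; rewrite enorm_le_dot// exprMn sqr_enorm /tr_model.
(* With [r] the deviation of [p] from the candidate, optimality and feasibility become inequalities
   in [dot g g], [dot g r], [dot r r], and the goal becomes [r = 0]. *)
rewrite !sqr_enorm; have -> : p = - s *: g + (p + s *: g).
  by rewrite scaleNr addrC addrK.
move: (p + s *: g) => r; rewrite !dotE (dotC r g) => le_m le_D.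
suff r0 : r = 0 by rewrite r0 addr0.
apply: dot_le0_eq0.
set G := dot g g in gg le_m le_D; set rr := dot r r in le_m le_D *.
set gr := dot g r in le_m le_D.
have {}le_m : rr + 2 * (mu - s) * gr <= 0.
  have : 2 * mu * ((2 * mu)^-1 * (rr - 2 * s * gr) + gr) <= 0.
    by rewrite pmulr_rle0 ?mulr_gt0//; lra.
  rewrite mulrDr mulrA mulfV ?mul1r; last by rewrite mulf_neq0// gt_eqF.
  lra.
have [mut|tmu] := leP mu t.
  have E : s = mu by rewrite /s; apply/min_idPl.
  by move: le_m; rewrite E subrr mulr0 mul0r addr0.
have E : s = t by rewrite /s; apply/min_idPr/ltW.
rewrite -E in le_D.
(* Feasibility weighted by [mu - s] plus optimality weighted by [s]: the [gr] terms cancel and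
   [mu * rr] remains. *)
suff : mu * rr <= 0 by rewrite pmulr_rle0.
have : (mu - s) * (rr - 2 * s * gr) <= 0.
  by rewrite mulr_ge0_le0 ?subr_ge0//; lra.
have : s * (rr + 2 * (mu - s) * gr) <= 0 by rewrite pmulr_rle0.
lra.
Qed.

(** The outer branches have the endpoint ratios; in the middle one the ratio is [alpha / t], with
    [t] between [gamma1^-1] and [gamma2^-1]. *)
Lemma tr_radiusE (R : realType) (alpha gamma1 gamma2 t : R) :
  0 < alpha -> 0 < gamma2 <= gamma1 -> 0 <= t ->
  exists2 r, alpha * gamma2 <= r <= alpha * gamma1 &
    tr_radius alpha gamma1 gamma2 t = r * t.
Proof.
move=> a0 /andP[g20 g21] t0; have g10 := lt_le_trans g20 g21.
rewrite /tr_radius; case: ltP => [_|t1].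
  by exists (alpha * gamma1); rewrite // lexx andbT ler_pM2l.
have t_gt0 : 0 < t by rewrite (lt_le_trans _ t1)// invr_gt0.
case: leP => [t2|_]; last first.
  by exists (alpha * gamma2); rewrite // lexx ler_pM2l.
exists (alpha / t); last by rewrite divfK ?gt_eqF.
rewrite !ler_pM2l//; apply/andP; split.
  by rewrite -[gamma2]invrK lef_pV2 ?posrE ?invr_gt0.
by rewrite -[leRHS]invrK lef_pV2 ?posrE ?invr_gt0.
Qed.

(** The step length is the smaller of [mu k w] and the radius ratio. The ratio gives the upper
    bound; the factor 4/5 comes from the lower bound on [mumin] and [gamma2 <= gamma1]. *)
Lemma TRishBB_step {d : measure_display} {T : measurableType d} {R : realType}
    {n : nat} {x0 : 'rV[R]_n} {alpha gamma1 gamma2 mumin mu0 : R}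
    {x g p : nat -> T -> 'rV[R]_n} {mu : nat -> T -> R} (k : nat) (w : T) :
  TRishBB x0 alpha gamma1 gamma2 mumin mu0 x g p mu ->
  4 * gamma1 * alpha / 5 <= mumin ->
  exists2 s, 4 / 5 * (alpha * gamma2) <= s <= alpha * gamma1 &
    x k.+1 w = x k w - s *: g k w.
Proof.
move=> A mum; have a0 := trish_alpha A.
have /andP[g20 g21] := trish_gamma A.
have [t /andP[lt tu] tE] : exists2 t, alpha * gamma2 <= t <= alpha * gamma1 &
    tr_radius alpha gamma1 gamma2 (enorm (g k w)) = t * enorm (g k w).
  by apply: tr_radiusE; rewrite ?enorm_ge0// g20.
have ag2 : 0 < alpha * gamma2 by rewrite mulr_gt0.
have ag12 : alpha * gamma2 <= alpha * gamma1 by rewrite ler_pM2l.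
have muk := trish_mu_ge A k w; have mu0' := trish_mumin A.
exists (Num.min (mu k w) t).
  by rewrite le_min ge_min tu orbT andbT; apply/andP; split; lra.
have := trish_step A k w; rewrite tE (trish_update A) -scaleNr.
by move=> /tr_solutionE ->//; lra.
Qed.

(* Young's inequality with weights [gamma2 / gamma1] and [gamma1 / gamma2]
   absorbs the cross term [dot h (g - h)]. *)
Lemma descent_bound {R : realType} {n : nat} (h g : 'rV[R]_n)
    {alpha gamma1 gamma2 L s : R} :
  0 < alpha -> 0 < gamma2 <= gamma1 -> 0 < L ->
  8 * gamma1 ^+ 2 * L * alpha <= gamma2 ->
  4 / 5 * (alpha * gamma2) <= s <= alpha * gamma1 ->
  - s * dot h g + L / 2 * (s ^+ 2 * dot g g) <=
  - (alpha * gamma2 / 16) * dot h h +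
  alpha * (gamma1 ^+ 2 / gamma2 - gamma2 / 16) * dot (h - g) (h - g).
Proof.
move=> a0 /andP[g20 g21] L0 La /andP[sl su].
have -> : g = h + (g - h) by rewrite addrC subrK.
move: (g - h) => e.
have -> : h - (h + e) = - e by rewrite opprD addNKr.
rewrite !dotE opprK (dotC e h).
have g10 := lt_le_trans g20 g21.
have ag2 : 0 < alpha * gamma2 by rewrite mulr_gt0.
have ag1 : 0 < alpha * gamma1 by rewrite mulr_gt0.
have s0 : 0 < s by lra.
(* [K] is the curvature coefficient; the smallness of [alpha] will bound it by
   [alpha * gamma2 / 16]. *)
set K := L / 2 * s ^+ 2.
have K0 : 0 <= K by rewrite mulr_ge0 ?sqr_ge0// divr_ge0// ltW.
have Kub : K <= alpha * gamma2 / 16.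
  have : s ^+ 2 <= (alpha * gamma1) ^+ 2 by rewrite ler_pXn2r// nnegrE ltW.
  rewrite -(ler_pM2l (_ : 0 < L / 2)) ?divr_gt0// => /le_trans; apply.
  have : alpha * (8 * gamma1 ^+ 2 * L * alpha) <= alpha * gamma2.
    by rewrite ler_pM2l.
  lra.
have hh := dot_ge0 h; have ee := dot_ge0 e.
have young : - dot h e <=
    (gamma2 / gamma1 * dot h h + gamma1 / gamma2 * dot e e) / 2.
  have := dot_ge0 (gamma2 *: h + gamma1 *: e).
  rewrite !dotE (dotC e h) => y.
  have : 0 <= (gamma1 * gamma2)^-1 *
      (gamma2 * (gamma2 * dot h h + gamma1 * dot h e) +
       gamma1 * (gamma2 * dot h e + gamma1 * dot e e)).
    by apply: mulr_ge0; [rewrite invr_ge0 mulr_ge0 ?ltW|lra].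
  have -> : (gamma1 * gamma2)^-1 *
      (gamma2 * (gamma2 * dot h h + gamma1 * dot h e) +
       gamma1 * (gamma2 * dot h e + gamma1 * dot e e)) =
      gamma2 / gamma1 * dot h h + gamma1 / gamma2 * dot e e + 2 * dot h e.
    by field; rewrite !gt_eqF.
  lra.
(* The linear term contributes [- s] and the quadratic one [2 * K] to the coefficient of [dot h e].
   Since the right side of [young] is nonnegative, [s - 2 * K] may be enlarged to
   [alpha * gamma1]. *)
have cross : - (s - 2 * K) * dot h e <=
    alpha * gamma2 / 2 * dot h h + alpha * (gamma1 ^+ 2 / gamma2) / 2 * dot e e.
  have sK0 : 0 <= s - 2 * K by lra.
  have sK1 : s - 2 * K <= alpha * gamma1 by lra.
  have -> : - (s - 2 * K) * dot h e = (s - 2 * K) * (- dot h e) by ring.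
  apply: (le_trans (ler_wpM2l sK0 young)).
  apply: (@le_trans _ _ (alpha * gamma1 *
      ((gamma2 / gamma1 * dot h h + gamma1 / gamma2 * dot e e) / 2))).
    by rewrite ler_wpM2r// divr_ge0// addr_ge0// mulr_ge0// divr_ge0 ?ltW.
  by rewrite le_eqVlt; apply/orP; left; apply/eqP; field; rewrite !gt_eqF.
have g12 : alpha * gamma2 <= alpha * (gamma1 ^+ 2 / gamma2).
  by rewrite ler_pM2l// ler_pdivlMr// -expr2 ler_pXn2r// nnegrE ltW.
(* The coefficient is at least [(4/5 - 1/16 - 1/16 - 1/2) * alpha * gamma2], which is positive. *)
have hcoef : (s - K - alpha * gamma2 / 16 - alpha * gamma2 / 2) * dot h h >= 0.
  by rewrite mulr_ge0//; lra.
have ecoef : 0 <= (alpha * (gamma1 ^+ 2 / gamma2 - gamma2 / 16) - K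
    - alpha * (gamma1 ^+ 2 / gamma2) / 2) * dot e e.
  by rewrite mulr_ge0//; lra.
have -> : L / 2 * (s ^+ 2 * (dot h h + dot h e + (dot h e + dot e e))) =
   K * (dot h h + 2 * dot h e + dot e e) by rewrite /K; ring.
lra.
Qed.

(** * Measurability, conditional bounds and the scalar recursion *)

Lemma measurable_comp_random_vector (d : measure_display)
    (T : measurableType d) (R : realType) (n : nat) (X : T -> 'rV[R]_n)
    (F : 'rV[R]_n -> R) :
  continuous F -> random_vector X -> measurable_fun setT (F \o X).
Proof.
move=> /continuousP cF rX; apply: (measurability _ (RGenOpens.measurableE R)).
move=> _ [_ [a [b ->]] <-]; rewrite setTI comp_preimage; apply: rX.
by apply: sub_sigma_algebra; apply: cF; exact: interval_open.
Qed.

(** On the whole space [X] and its version [Y] have equal integrals. As [Y] may be negative, the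
    bound passes through its positive part, which stays below [M] almost everywhere because
    [0 <= M]. *)
Lemma cond_expectation_le_integral (d : measure_display)
    (T : measurableType d) (R : realType) (P : probability T R)
    (G : set (set T)) (X : T -> R) (M : R) :
  0 <= M -> G setT -> cond_expectation_le P G X M ->
  (\int[P]_w (X w)%:E <= M%:E)%E.
Proof.
move=> M0 GT [Y [_ _ iY XY] YM]; rewrite XY//.
apply: (@le_trans _ _ (\int[P]_w ((EFin \o Y)^\+ w))%E).
  rewrite integralE -[leRHS]adde0 leeD2l// oppe_le0.
  by apply: integral_ge0 => w _; exact: funeneg_ge0.
have -> : M%:E = (\int[P]_w cst M%:E w)%E.
  by rewrite integral_cst//= probability_setT mule1.
have mY := measurable_int P iY.
apply: ae_ge0_le_integral => //.
- exact: measurable_funepos.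
- by apply: filterS YM => w YM _; rewrite funeposE ge_max !lee_fin YM.
Qed.

Lemma sigma_of_setT (d : measure_display) (T : measurableType d)
    (R : realType) (n : nat) (X : T -> 'rV[R]_n) : sigma_of X setT.
Proof.
by exists setT; [apply: sub_sigma_algebra; exact: openT|rewrite preimage_setT setIT].
Qed.

(** [C] is the fixed point of the recursion, so the excess over it contracts by [q]. Values in
    [\bar R] allow its use before finiteness is known. *)
Lemma affine_recursion_bound {R : realType} {q C : R} (D : R)
    {a : nat -> \bar R} : 0 <= q ->
  (a 0%N <= (D + C)%:E)%E ->
  (forall k, a k.+1 <= q%:E * a k + ((1 - q) * C)%:E)%E ->
  forall k, (a k <= (q ^+ k * D + C)%:E)%E.
Proof.
move=> q0 a0 aS; elim=> [|k IH]; first by rewrite expr0 mul1r.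
apply: (le_trans (aS k)).
have -> : q ^+ k.+1 * D + C = q * (q ^+ k * D + C) + (1 - q) * C.
  by rewrite exprS; ring.
by rewrite EFinD leeD2r// EFinM lee_wpmul2l// lee_fin.
Qed.

(** * Recursion for the expected gap and its limit *)

Theorem theorem3p3 (R : realType) (d : measure_display) (T : measurableType d)
    (P : probability T R) (n N : nat)
    (fi : 'I_N -> 'rV[R]_n -> R) (f : 'rV[R]_n -> R)
    (x0 : 'rV[R]_n) (alpha gamma1 gamma2 mumin mu0 : R)
    (x g p : nat -> T -> 'rV[R]_n) (mu : nat -> T -> R)
    (fstar L c Mg : R) :
  (0 < N)%N ->
  (forall i, continuously_differentiable (fi i)) ->
  (forall y, f y = N%:R^-1 * \sum_(i < N) fi i y) ->
  TRishBB x0 alpha gamma1 gamma2 mumin mu0 x g p mu ->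
  continuously_differentiable f ->
  (forall y, fstar <= f y) ->
  0 < L ->
  (forall y z, f y <= f z + dot (grad f z) (y - z)
                      + L / 2 * enorm (y - z) ^+ 2) ->
  0 < c ->
  (forall y, 2 * c * (f y - fstar) <= enorm (grad f y) ^+ 2) ->
  (forall k i, is_cond_expectation P (sigma_of (x k))
                 (fun w => g k w 0 i) (fun w => grad f (x k w) 0 i)) ->
  0 < Mg ->
  (forall k, cond_expectation_le P (sigma_of (x k))
               (fun w => enorm (grad f (x k w) - g k w) ^+ 2) Mg) ->
  0 < alpha < Num.min (gamma2 / (8 * gamma1 ^+ 2 * L)) (8 / (gamma2 * c)) ->
  4 * gamma1 * alpha / 5 <= mumin ->
  let theta3 := gamma1 ^+ 2 / gamma2 - gamma2 / 16 in
  exists b : nat -> R,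
    (forall k, ('E_P[(fun w => f (x k.+1 w))] - fstar%:E <= (b k)%:E)%E) /\
    b k @[k --> \oo] --> 8 * theta3 * Mg / (gamma2 * c).
Proof.
move=> _ _ _ A [df _] fge L0 fL c0 PL _ Mg0 gM /andP[a0 aub] mum theta3.
have g012 := trish_gamma A; have /andP[g20 g21] := g012.
have g10 := lt_le_trans g20 g21.
move: aub; rewrite lt_min => /andP[].
rewrite !ltr_pdivlMr ?mulr_gt0 ?exprn_gt0// => aL ac.
have theta0 : 0 < theta3.
  have : gamma2 <= gamma1 ^+ 2 / gamma2.
    by rewrite ler_pdivlMr// -expr2 ler_pXn2r// nnegrE ltW.
  by rewrite /theta3; lra.
set q : R := 1 - alpha * gamma2 * c / 8.
(* This is where [alpha < 8 / (gamma2 * c)] enters. *)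
have q0 : 0 <= q by rewrite /q; lra.
have q1 : q < 1.
  by rewrite /q ltrBlDr ltrDl divr_gt0 ?mulr_gt0.
set C := 8 * theta3 * Mg / (gamma2 * c).
have C0 : 0 <= C by rewrite ltW// divr_gt0 ?mulr_gt0.
pose gap k w := f (x k w) - fstar.
pose err k w := enorm (grad f (x k w) - g k w) ^+ 2.
have gap_ge0 k w : 0 <= gap k w by rewrite subr_ge0.
have gap_step k w : gap k.+1 w <= q * gap k w + alpha * theta3 * err k w.
  have [s sb xS] := TRishBB_step k w A mum.
  have /= := fL (x k.+1 w) (x k w); rewrite {2 3}xS [x k w - _ - _]addrAC.
  rewrite subrr add0r sqr_enorm !dotE.
  have := descent_bound (grad f (x k w)) (g k w) a0 g012 L0 _ sb.
  have /[swap]/[apply] : 8 * gamma1 ^+ 2 * L * alpha <= gamma2 by lra.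
  (* The Polyak-Lojasiewicz inequality at this weight yields the factor [alpha * gamma2 * c / 8] in
     [q]. *)
  have : alpha * gamma2 / 16 * (2 * c * (f (x k w) - fstar)) <=
         alpha * gamma2 / 16 * enorm (grad f (x k w)) ^+ 2.
    by rewrite ler_pM2l// divr_gt0// mulr_gt0.
  rewrite sqr_enorm /gap /err sqr_enorm -/theta3 /q; lra.
have mgap k : measurable_fun setT (fun w => (gap k w)%:E).
  apply/measurable_EFinP/measurable_funB => //.
  apply: (@measurable_comp_random_vector _ _ _ _ _ f).
    by move=> y; exact/differentiable_continuous.
  exact: trish_x_random A k.
have merr k : measurable_fun setT (fun w => (err k w)%:E).
  by have [Y [_ /(measurable_int P)]] := gM k.
pose a k := (\int[P]_w (gap k w)%:E)%E.
have a_step k : (a k.+1 <= q%:E * a k + ((1 - q) * C)%:E)%E.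
  apply: (@le_trans _ _ (\int[P]_w (q%:E * (gap k w)%:E +
      (alpha * theta3)%:E * (err k w)%:E))%E).
    apply: ge0_le_integral => //.
    - by move=> w _; rewrite lee_fin.
    - by apply: emeasurable_funD; exact: measurable_funeM.
    - by move=> w _; rewrite -!EFinM -EFinD lee_fin.
  have at0 : 0 <= alpha * theta3 by rewrite mulr_ge0 ?ltW.
  have err0 k' w : (0 <= (err k' w)%:E)%E by rewrite lee_fin sqr_ge0.
  rewrite ge0_integralD//; first last.
  - exact: measurable_funeM.
  - by move=> w _; rewrite mule_ge0// lee_fin.
  - exact: measurable_funeM.
  - by move=> w _; rewrite mule_ge0// lee_fin.
  rewrite !ge0_integralZl_EFin//; first last.
  - by move=> w _; rewrite lee_fin.
  rewrite leeD2l//.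
  have -> : (1 - q) * C = alpha * theta3 * Mg.
    by rewrite /q /C; field; rewrite !gt_eqF.
  rewrite [((_ * Mg)%:E)]EFinM lee_wpmul2l ?lee_fin//.
  apply: cond_expectation_le_integral (gM k); first exact: ltW.
  exact: sigma_of_setT.
have a_bound := affine_recursion_bound (f x0 - fstar) q0 _ a_step.
(* The exponent is [k.+1] because the claim concerns [x k.+1]. The initial gap equals
   [f x0 - fstar], which is below [f x0 - fstar + C] as [0 <= C]. *)
exists (fun k => q ^+ k.+1 * (f x0 - fstar) + C); split; last first.
  rewrite -[X in _ --> X]add0r; apply: cvgD; last exact: cvg_cst.
  rewrite -[X in _ --> X](mul0r (f x0 - fstar)).
  apply: cvgM; last exact: cvg_cst.
  have := @cvg_expr R q; rewrite ger0_norm// => /(_ q1).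
  by rewrite -(cvg_shiftS (fun k => q ^+ k)).
move=> k.
have {}a_bound : (a k.+1 <= (q ^+ k.+1 * (f x0 - fstar) + C)%:E)%E.
  apply: a_bound; rewrite /a /gap (eq_integral (cst (f x0 - fstar)%:E)).
    by rewrite integral_cst//= probability_setT mule1 lee_fin lerDl.
  by move=> w _; rewrite (trish_x_init A).
(* The gap is nonnegative, so the finite bound on [a k.+1] makes it integrable; only then can the
   expectation of [f] be split into [a k.+1] and [fstar]. *)
have igap : P.-integrable setT (EFin \o gap k.+1).
  apply/integrableP; split; first exact: mgap.
  under eq_integral do rewrite gee0_abs ?lee_fin//.
  exact: le_lt_trans a_bound (ltry _).
have ifstar : P.-integrable setT (EFin \o cst fstar).
  exact: finite_measure_integrable_cst.
apply: le_trans a_bound.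
rewrite unlock [X in (X - _)%E](_ : _ = a k.+1 + fstar%:E)%E ?addeK//.
rewrite (eq_integral (fun w => (gap k.+1 w)%:E + (cst fstar w)%:E)%E); last first.
  by move=> w _; rewrite -EFinD subrK.
by rewrite integralD_EFin//= integral_cst//= probability_setT mule1.
Qed.
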